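(* Let $k$ be a commutative Noetherian ring and let $V$ be a finitely generated $\mathscr{C}$-module. Then the following statements are equivalent: (1) $V$ is $\sharp$-filtered; (2) $\mathrm{hd}_s(V) = -\infty$ for all $s \geqslant 1$; (3) $\mathrm{hd}_1(V) = -\infty$; (4) $\mathrm{hd}_s(V) = -\infty$ for some $s \geqslant 1$.
   Context: $\mathscr{C}$ is the category with objects $[n]=\{1,\dots,n\}$, $n\in\mathbb{Z}_+=\{0,1,2,\dots\}$ ($[0]=\emptyset$), and morphisms the injections (a skeleton of FI); the object $[n]$ is also written $n$. $\underline{\mathscr{C}}$ is its $k$-linearization, so $\underline{\mathscr{C}}(i,j)$ is the free $k$-module on $\mathscr{C}(i,j)$, and $\underline{\mathscr{C}}(i,i)=kS_i$. A $\mathscr{C}$-module is a covariant functor $V$ from $\mathscr{C}$ to $k$-modules, $V_i$ being its value at $[i]$. It is finitely generated if it is a quotient of a finite direct sum of modules $\underline{\mathscr{C}}(i,-)$. Torsion degree: $\mathrm{td}(V)=\sup\{i\in\mathbb{Z}_+ \mid \mathrm{Hom}_{\underline{\mathscr{C}}}(\underline{\mathscr{C}}(i,i),V)\neq 0\}$, or $-\infty$ if this set is empty, where $\underline{\mathscr{C}}(i,i)$ is regarded as a $\mathscr{C}$-module concentrated at the object $i$; equivalently it is the supremum of the $i$ for which there are $0\neq v\in V_i$ and $\alpha\in\mathscr{C}(i,i+1)$ with $\alpha\cdot v=0$. Homology: let $J=\bigoplus_{0\leqslant i<j}\underline{\mathscr{C}}(i,j)$, a two-sided ideal of $\underline{\mathscr{C}}$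 (viewed as a non-unital $k$-algebra), and $\underline{\mathscr{C}}_0=\underline{\mathscr{C}}/J$. Then $H_0(V)=V/JV\cong\underline{\mathscr{C}}_0\otimes_{\underline{\mathscr{C}}}V$ and $H_s(V)=\mathrm{Tor}_s^{\underline{\mathscr{C}}}(\underline{\mathscr{C}}_0,V)$ (the $s$-th left derived functor of $H_0$). The $s$-th homological degree is $\mathrm{hd}_s(V)=\mathrm{td}(H_s(V))$. A basic $\sharp$-filtered module is a $\mathscr{C}$-module of the form $\underline{\mathscr{C}}\otimes_{kS_i}T$, i.e. $n\mapsto \underline{\mathscr{C}}(i,n)\otimes_{kS_i}T$, for some $i\in\mathbb{Z}_+$ and some $kS_i$-module $T$. A finitely generated $\mathscr{C}$-module $V$ is $\sharp$-filtered if it has a finite filtration $0=V^{-1}\subseteq V^0\subseteq\dots\subseteq V^n=V$ by submodules such that each $V^{j+1}/V^j$ is isomorphic to a basic $\sharp$-filtered module. *)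

(* Defs.v *)
From HB Require Import structures.
From mathcomp Require Import all_boot all_order all_algebra.
From mathcomp Require Import boolp classical_sets functions cardinality fsbigop.
From mathcomp Require Import constructive_ereal.

Set Implicit Arguments.
Unset Strict Implicit.
Unset Printing Implicit Defensive.

Import Order.TTheory GRing.Theory Num.Theory.
Local Open Scope ring_scope.
Local Open Scope quotient_scope.

(* Every ideal is finitely generated; a submodule of k^o is an ideal, possibly
   improper. *)
Definition noetherian (k : comPzRingType) : Prop :=
  forall I : submodClosed k^o,
  exists (r : nat) (a : 'I_r -> k),
    forall x : k, x \in I <-> exists c : 'I_r -> k, x = \sum_j c j * a j.

Section Modules.
Variable k : pzRingType.

Definition mk_linear (U V : lmodType k) (f : U -> V) (fL : linear f) :
  {linear U -> V} := HB.pack f (GRing.isLinear.Build k U V *:%R f fL).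

Definition mk_submod (V : lmodType k) (S : pred V)
    (SP : subsemimod_closed S) : submodClosed V :=
  HB.pack S (GRing.isSubmodClosed.Build k V S SP).

Definition mk_zmod (V : zmodType) (S : pred V) (SP : zmod_closed S) :
  zmodClosed V := HB.pack S (GRing.isZmodClosed.Build V S SP).

Section Sub.
Variables (V : lmodType k) (S : submodClosed V).

Record subm := Subm { subm_val : V; _ : subm_val \in S }.
HB.instance Definition _ := [isSub for subm_val].
HB.instance Definition _ := [Choice of subm by <:].
HB.instance Definition _ := [SubChoice_isSubLmodule of subm by <:].
End Sub.

Section Quo.
Variables (V : lmodType k) (S : submodClosed V).

Definition submod_zmod : zmodClosed V :=
  mk_zmod (GRing.subsemimod_closedB (GRing.subsemimodClosedP S)).
Definition quom := Quotient.quot submod_zmod.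
HB.instance Definition _ := GRing.Zmodule.on quom.

Definition quom_pi (x : V) : quom := \pi_(Quotient.quot submod_zmod) x.
Definition quom_repr (x : quom) : V := repr (x : Quotient.quot submod_zmod).

Lemma quom_reprK : cancel quom_repr quom_pi.
Proof. exact: reprK. Qed.

Lemma quom_eq (x y : V) : (quom_pi x = quom_pi y) <-> (x - y \in S).
Proof.
rewrite -[x - y \in S]/(x - y \in submod_zmod) Quotient.idealrBE.
by split=> [/eqP|/eqP].
Qed.

Lemma quom_piD (x y : V) : quom_pi (x + y) = quom_pi x + quom_pi y.
Proof. exact: (raddfD (\pi_(Quotient.quot submod_zmod))). Qed.

Lemma quom_pi_repr (x : V) : quom_repr (quom_pi x) - x \in S.
Proof. by apply/quom_eq; rewrite quom_reprK. Qed.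

Definition quom_scale (a : k) (x : quom) : quom := quom_pi (a *: quom_repr x).

Lemma quom_piZ a (x : V) : quom_pi (a *: x) = quom_scale a (quom_pi x).
Proof.
apply/esym/quom_eq; rewrite -scalerBr rpredZ //; exact: quom_pi_repr.
Qed.

Fact quom_scaleA a b x : quom_scale a (quom_scale b x) = quom_scale (a * b) x.
Proof. by rewrite -[x]quom_reprK -!quom_piZ scalerA. Qed.
Fact quom_scale1 : left_id 1 quom_scale.
Proof. by move=> x; rewrite -[x]quom_reprK -!quom_piZ scale1r. Qed.
Fact quom_scaleDr : right_distributive quom_scale +%R.
Proof.
move=> a x y; rewrite -[x]quom_reprK -[y]quom_reprK.
by rewrite -quom_piD -!quom_piZ -quom_piD scalerDr.
Qed.
Fact quom_scaleDl x : {morph quom_scale^~ x : a b / a + b}.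
Proof.
by move=> a b; rewrite -[x]quom_reprK -!quom_piZ -quom_piD scalerDl.
Qed.
HB.instance Definition _ := GRing.Zmodule_isLmodule.Build k quom
  quom_scaleA quom_scale1 quom_scaleDr quom_scaleDl.

Lemma quom_pi_linear : linear quom_pi.
Proof. by move=> a x y; rewrite quom_piD quom_piZ. Qed.
End Quo.

(* The map V / S -> W / S' induced by f : V -> W, provided f S is contained
   in S'. *)
Section QuoMap.
Variables (V W : lmodType k) (S : submodClosed V) (S' : submodClosed W).
Variables (f : {linear V -> W}) (fS : forall x, x \in S -> f x \in S').

Definition quom_map_fun (x : quom S) : quom S' := quom_pi S' (f (quom_repr x)).

Lemma quom_map_pi x : quom_map_fun (quom_pi S x) = quom_pi S' (f x).
Proof. by apply/quom_eq; rewrite -raddfB; apply/fS/quom_pi_repr. Qed.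

Lemma quom_map_linear : linear quom_map_fun.
Proof.
move=> a x y; rewrite -[x]quom_reprK -[y]quom_reprK -quom_pi_linear.
by rewrite !quom_map_pi linearP quom_pi_linear.
Qed.
Definition quom_map : {linear quom S -> quom S'} := mk_linear quom_map_linear.
End QuoMap.

Section Span.
Variables (V : lmodType k) (A : set V).

Definition in_span : pred V := fun x =>
  `[< forall S : submodClosed V, (forall a, A a -> a \in S) -> x \in S >].

Lemma span_closed : subsemimod_closed in_span.
Proof.
split; first split.
- by apply/asboolP => S _; exact: rpred0.
- move=> x y /asboolP xS /asboolP yS; apply/asboolP => S AS.
  by rewrite rpredD ?xS ?yS.
- move=> a x /asboolP xS; apply/asboolP => S AS.
  by rewrite rpredZ ?xS.
Qed.
Definition span : submodClosed V := mk_submod span_closed.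

Lemma mem_span x : A x -> x \in span.
Proof. by move=> Ax; apply/asboolP => S; exact. Qed.
End Span.

Lemma preim_closed (V W : lmodType k) (f : {linear V -> W})
  (S : submodClosed W) : subsemimod_closed (fun x => f x \in S).
Proof.
split; first split.
- by rewrite unfold_in raddf0 rpred0.
- by move=> x y xS yS; rewrite unfold_in raddfD; exact: rpredD xS yS.
- by move=> a x xS; rewrite unfold_in linearZ; exact: rpredZ xS.
Qed.
Definition preim_sub (V W : lmodType k) (f : {linear V -> W})
  (S : submodClosed W) : submodClosed V := mk_submod (preim_closed f S).

Lemma span_map (V W : lmodType k) (A : set V) (S : submodClosed W)
    (f : {linear V -> W}) :
  (forall a, A a -> f a \in S) -> forall x, x \in span A -> f x \in S.
Proof. by move=> fA x /asboolP /(_ (preim_sub f S)); exact. Qed.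

Lemma ker_closed (V W : lmodType k) (f : {linear V -> W}) :
  subsemimod_closed (fun x => f x == 0).
Proof.
split; first split.
- by rewrite unfold_in raddf0.
- by move=> x y /eqP xK /eqP yK; rewrite unfold_in linearD /= xK yK addr0.
- by move=> a x /eqP xK; rewrite unfold_in linearZ /= xK scaler0.
Qed.

Lemma img_closed (V W : lmodType k) (f : {linear V -> W}) :
  subsemimod_closed (fun y => `[< exists x, f x = y >]).
Proof.
split; first split.
- by apply/asboolP; exists 0; rewrite raddf0.
- move=> _ _ /asboolP[x <-] /asboolP[y <-].
  by apply/asboolP; exists (x + y); rewrite raddfD.
- move=> a _ /asboolP[x <-]; apply/asboolP.
  by exists (a *: x); rewrite linearZ.
Qed.

Section Product.
Variables (I : Type) (M : I -> lmodType k).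

Definition dprod := forall a : I, M a.
HB.instance Definition _ := gen_eqMixin dprod.
HB.instance Definition _ := gen_choiceMixin dprod.

Let add (x y : dprod) : dprod := fun a => x a + y a.
Let opp (x : dprod) : dprod := fun a => - x a.
Let zero : dprod := fun=> 0.
Let scale c (x : dprod) : dprod := fun a => c *: x a.

Fact dprod_addA : associative add.
Proof. by move=> x y z; apply: functional_extensionality_dep => a; exact: addrA. Qed.
Fact dprod_addC : commutative add.
Proof. by move=> x y; apply: functional_extensionality_dep => a; exact: addrC. Qed.
Fact dprod_add0 : left_id zero add.
Proof. by move=> x; apply: functional_extensionality_dep => a; exact: add0r. Qed.
Fact dprod_addN : left_inverse zero opp add.
Proof. by move=> x; apply: functional_extensionality_dep => a; exact: addNr. Qed.
HB.instance Definition _ :=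
  GRing.isZmodule.Build dprod dprod_addA dprod_addC dprod_add0 dprod_addN.

Fact dprod_scaleA c d x : scale c (scale d x) = scale (c * d) x.
Proof. by apply: functional_extensionality_dep => a; exact: scalerA. Qed.
Fact dprod_scale1 : left_id 1 scale.
Proof. by move=> x; apply: functional_extensionality_dep => a; exact: scale1r. Qed.
Fact dprod_scaleDr : right_distributive scale +%R.
Proof. by move=> c x y; apply: functional_extensionality_dep => a; exact: scalerDr. Qed.
Fact dprod_scaleDl x : {morph scale^~ x : c d / c + d}.
Proof. by move=> c d; apply: functional_extensionality_dep => a; exact: scalerDl. Qed.
HB.instance Definition _ := GRing.Zmodule_isLmodule.Build k dprod
  dprod_scaleA dprod_scale1 dprod_scaleDr dprod_scaleDl.

Lemma finsupp_closed :
  subsemimod_closed (fun x : dprod => `[< finite_set [set a | x a != 0] >]).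
Proof.
split; first split.
- apply/asboolP; apply: (@sub_finite_set _ _ set0) => // a /=.
  by rewrite eqxx.
- move=> x y /asboolP xF /asboolP yF; apply/asboolP.
  apply: (@sub_finite_set _ _ ([set a | x a != 0] `|` [set a | y a != 0])%classic).
    move=> a /=; apply: contra_neqP => /not_orP[/negP/negPn/eqP xa0].
    by move=> /negP/negPn/eqP ya0; rewrite [LHS]/(x a + y a) xa0 ya0; exact: addr0.
  by rewrite finite_setU.
- move=> c x /asboolP xF; apply/asboolP; apply: sub_finite_set xF => a /=.
  by apply: contra_neq => xa0; rewrite [LHS]/(c *: x a) xa0; exact: scaler0.
Qed.
Definition finsupp : submodClosed dprod := mk_submod finsupp_closed.

End Product.
End Modules.

(* The objects are the natural numbers, n standing for the set 'I_n. *)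
Definition inj (m n : nat) := {f : {ffun 'I_m -> 'I_n} | injectiveb f}.
HB.instance Definition _ m n := Finite.on (inj m n).

Definition inj_fun m n (f : inj m n) : 'I_m -> 'I_n := val f.
Coercion inj_fun : inj >-> Funclass.

Lemma injP m n (f g : inj m n) : f =1 g -> f = g.
Proof. by move=> fg; apply/val_inj/ffunP. Qed.

Lemma inj_inj m n (f : inj m n) : injective f.
Proof. exact/injectiveP/(valP f). Qed.

Lemma inj_leq m n (f : inj m n) : (m <= n)%N.
Proof. by have := leq_card f (@inj_inj _ _ f); rewrite !card_ord. Qed.

Fact mk_inj_proof m n (f : 'I_m -> 'I_n) :
  injective f -> injectiveb [ffun i => f i].
Proof. by move=> fI; apply/injectiveP => i j; rewrite !ffunE => /fI. Qed.
Definition mk_inj m n (f : 'I_m -> 'I_n) (fI : injective f) : inj m n :=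
  Sub [ffun i => f i] (mk_inj_proof fI).

Lemma mk_injE m n (f : 'I_m -> 'I_n) (fI : injective f) : mk_inj fI =1 f.
Proof. by move=> i; rewrite /inj_fun /= ffunE. Qed.

Definition iid n : inj n n := mk_inj (fun (i j : 'I_n) (e : i = j) => e).

Definition icomp m n p (g : inj n p) (f : inj m n) : inj m p :=
  mk_inj (inj_comp (@inj_inj _ _ g) (@inj_inj _ _ f)).

Lemma icompA m n p q (h : inj p q) (g : inj n p) (f : inj m n) :
  icomp h (icomp g f) = icomp (icomp h g) f.
Proof. by apply: injP => i; rewrite !mk_injE /= !mk_injE. Qed.
Lemma icomp1f m n (f : inj m n) : icomp (iid n) f = f.
Proof. by apply: injP => i; rewrite !mk_injE /= !mk_injE. Qed.
Lemma icompf1 m n (f : inj m n) : icomp f (iid m) = f.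
Proof. by apply: injP => i; rewrite !mk_injE /= !mk_injE. Qed.

Section CModules.
Variable k : comPzRingType.

Record cmod := CMod {
  cm_at :> nat -> lmodType k;
  act : forall m n, inj m n -> {linear cm_at m -> cm_at n};
  act_id : forall n (v : cm_at n), act (iid n) v = v;
  act_comp : forall m n p (g : inj n p) (f : inj m n) (v : cm_at m),
    act (icomp g f) v = act g (act f v) }.

Record chom (V W : cmod) := CHom {
  hom_at :> forall n, {linear V n -> W n};
  hom_act : forall m n (f : inj m n) (v : V m),
    hom_at n (act V f v) = act W f (hom_at m v) }.

Definition hom_nonzero V W (phi : chom V W) : Prop :=
  exists n (v : V n), phi n v <> 0.

Definition chom_surj V W (phi : chom V W) : Prop :=
  forall n (w : W n), exists v : V n, phi n v = w.

Definition cmod_iso (V W : cmod) : Prop :=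
  exists phi : chom V W, forall n, bijective (phi n).

Section Comp.
Variables (U V W : cmod) (g : chom V W) (f : chom U V).
Fact hom_comp_act m n (h : inj m n) (v : U m) :
  (g n \o f n) (act U h v) = act W h ((g m \o f m) v).
Proof. by rewrite /= !hom_act. Qed.
Definition hom_comp : chom U W := CHom hom_comp_act.
End Comp.

Record csub (V : cmod) := CSub {
  cs_at :> forall n, submodClosed (V n);
  cs_act : forall m n (f : inj m n) v, v \in cs_at m -> act V f v \in cs_at n }.

Section Submodule.
Variables (V : cmod) (S : csub V).

Section Act.
Variables (m n : nat) (f : inj m n).
Definition sub_act_fun (v : subm (S m)) : subm (S n) :=
  Subm (cs_act f (valP v)).
Fact sub_act_linear : linear sub_act_fun.
Proof. by move=> a u v; apply: val_inj; rewrite /= !linearP. Qed.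
Definition sub_act := mk_linear sub_act_linear.
End Act.

Fact sub_act_id n v : sub_act (iid n) v = v.
Proof. by apply: val_inj; exact: act_id. Qed.
Fact sub_act_comp m n p (g : inj n p) (f : inj m n) v :
  sub_act (icomp g f) v = sub_act g (sub_act f v).
Proof. by apply: val_inj; exact: act_comp. Qed.

Definition sub_cmod : cmod :=
  @CMod (fun n => subm (S n)) sub_act sub_act_id sub_act_comp.

Fact incl_linear n : linear (fun v : sub_cmod n => val v : V n).
Proof. by move=> a u v; rewrite linearP. Qed.
Definition incl : chom sub_cmod V :=
  @CHom sub_cmod V (fun n => mk_linear (@incl_linear n)) (fun m n f v => erefl).
End Submodule.

Section Quotient.
Variables (V : cmod) (S : csub V).

Definition quo_act m n (f : inj m n) : {linear quom (S m) -> quom (S n)} :=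
  quom_map (@cs_act V S m n f).

Fact quo_act_id n v : quo_act (iid n) v = v.
Proof.
by rewrite -[v]quom_reprK [LHS](quom_map_pi (@cs_act V S _ _ _)) act_id.
Qed.
Fact quo_act_comp m n p (g : inj n p) (f : inj m n) v :
  quo_act (icomp g f) v = quo_act g (quo_act f v).
Proof.
rewrite -[v]quom_reprK [LHS](quom_map_pi (@cs_act V S _ _ _)) act_comp.
by rewrite [X in quo_act g X](quom_map_pi (@cs_act V S _ _ _))
   [RHS](quom_map_pi (@cs_act V S _ _ _)).
Qed.

Definition quo_cmod : cmod :=
  @CMod (fun n => quom (S n)) quo_act quo_act_id quo_act_comp.
End Quotient.

Section QuotientMap.
Variables (V W : cmod) (S : csub V) (S' : csub W) (phi : chom V W).
Hypothesis phiS : forall n v, v \in S n -> phi n v \in S' n.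

Fact quo_hom_act m n (f : inj m n) v :
  quom_map (@phiS n) (act (quo_cmod S) f v) =
  act (quo_cmod S') f (quom_map (@phiS m) v).
Proof.
rewrite -[v]quom_reprK; set u := quom_repr v.
transitivity (quom_pi (S' n) (phi n (act V f u))).
  rewrite [X in quom_map _ X](quom_map_pi (@cs_act V S _ _ _)).
  exact: (quom_map_pi (@phiS n)).
transitivity (act (quo_cmod S') f (quom_pi (S' m) (phi m u))).
  by rewrite hom_act; apply/esym/(quom_map_pi (@cs_act _ S' _ _ _)).
by apply: congr1; apply/esym/(quom_map_pi (@phiS m)).
Qed.
Definition quo_hom : chom (quo_cmod S) (quo_cmod S') :=
  @CHom (quo_cmod S) (quo_cmod S') (fun n => quom_map (@phiS n)) quo_hom_act.
End QuotientMap.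

Section KerImg.
Variables (V W : cmod) (phi : chom V W).

Fact cker_act m n (f : inj m n) v :
  v \in mk_submod (ker_closed (phi m)) ->
  act V f v \in mk_submod (ker_closed (phi n)).
Proof.
by move=> /eqP phiv; apply/eqP; rewrite hom_act [phi m v]phiv linear0.
Qed.
Definition cker : csub V := CSub cker_act.

Fact cimg_act m n (f : inj m n) w :
  w \in mk_submod (img_closed (phi m)) ->
  act W f w \in mk_submod (img_closed (phi n)).
Proof.
move=> /asboolP[v <-]; apply/asboolP; exists (act V f v).
by rewrite hom_act.
Qed.
Definition cimg : csub W := CSub cimg_act.

Fact cpreim_act (S : csub W) m n (f : inj m n) v :
  v \in preim_sub (phi m) (S m) -> act V f v \in preim_sub (phi n) (S n).
Proof.
by move=> vS; rewrite [_ \in _]unfold_in hom_act; exact: cs_act vS.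
Qed.
Definition cpreim (S : csub W) : csub V := CSub (@cpreim_act S).
End KerImg.

(* B / (A :&: B). *)
Definition subquo V (A B : csub V) : cmod := quo_cmod (cpreim (incl B) A).

Section Ind.
Variables (i : nat) (T : lmodType k).

(* The k-module C(i,n) (x)_k T, with x : {ffun inj i n -> T} standing for
   \sum_g g (x) x g.  An injection f acts by g (x) t |-> (f \o g) (x) t. *)
Section Act.
Variables (m n : nat) (f : inj m n).
Definition ind_act_fun (x : {ffun inj i m -> T}) : {ffun inj i n -> T} :=
  [ffun g => \sum_(h | icomp f h == g) x h].
Fact ind_act_linear : linear ind_act_fun.
Proof.
move=> a x y; apply/ffunP => g; rewrite !ffunE scaler_sumr -big_split /=.
by apply: eq_bigr => h _; rewrite !ffunE.
Qed.
Definition ind_act := mk_linear ind_act_linear.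
End Act.

Fact ind_act_id n x : ind_act (iid n) x = x.
Proof.
apply/ffunP => g; rewrite ffunE (big_pred1 g) // => h.
by rewrite icomp1f.
Qed.
Fact ind_act_comp m n p (g : inj n p) (f : inj m n) x :
  ind_act (icomp g f) x = ind_act g (ind_act f x).
Proof.
apply/ffunP => h; rewrite !ffunE.
under [RHS]eq_bigr do rewrite ffunE.
rewrite [RHS](exchange_big_dep xpredT) //= [LHS]big_mkcond /=.
apply: eq_bigr => j _; rewrite (eq_bigl (fun u =>
    (icomp (icomp g f) j == h) && (u == icomp f j))); last first.
  by move=> u; rewrite (eq_sym u) -icompA; case: (icomp f j =P u) => [->|];
     rewrite ?andbT ?andbF.
by case: ifP => _; rewrite /= ?big_pred1_eq ?big_pred0_eq.
Qed.
Definition ind : cmod :=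
  @CMod (fun n => {ffun inj i n -> T}) ind_act ind_act_id ind_act_comp.

Definition ind_tensor n (g : inj i n) (t : T) : ind n :=
  [ffun h => if h == g then t else 0].

Lemma ind_act_tensor m n (f : inj m n) (g : inj i m) t :
  act ind f (ind_tensor g t) = ind_tensor (icomp f g) t.
Proof.
apply/ffunP => h; rewrite !ffunE big_mkcond /= (bigD1 g) //= ffunE eqxx.
rewrite big1 ?addr0 => [|j /negPf jg]; first by rewrite eq_sym.
by rewrite ffunE jg if_same.
Qed.
End Ind.

(* C(i,-): the k-module at n is free on inj i n. *)
Definition principal (i : nat) : cmod := ind i k^o.

(* The map principal i -> V sending the identity of [i] to v. *)
Section Yoneda.
Variables (V : cmod) (i : nat) (v : V i).
Definition yoneda_fun n (x : principal i n) : V n := \sum_(f : inj i n) x f *: act V f v.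
Fact yoneda_linear n : linear (@yoneda_fun n).
Proof.
move=> a x y; rewrite /yoneda_fun scaler_sumr -big_split /=.
by apply: eq_bigr => f _; rewrite !ffunE scalerDl scalerA.
Qed.
Fact yoneda_act m n (f : inj m n) (x : principal i m) :
  yoneda_fun (act (principal i) f x) = act V f (yoneda_fun x).
Proof.
rewrite /yoneda_fun linear_sum /=.
under eq_bigr do rewrite ffunE scaler_suml.
rewrite (exchange_big_dep xpredT) //=; apply: eq_bigr => h _.
by rewrite (big_pred1 (icomp f h)) ?act_comp ?linearZ // => g; rewrite /= eq_sym.
Qed.
Definition yoneda : chom (principal i) V :=
  @CHom (principal i) V (fun n => mk_linear (@yoneda_linear n)) yoneda_act.
End Yoneda.

Section DirectSum.
Variables (I : choiceType) (W : I -> cmod).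

Let prod n := dprod (fun a => W a n).
Let dsum_at n : lmodType k := subm (finsupp (fun a => W a n)).

Section Act.
Variables (m n : nat) (f : inj m n).
Definition prod_act (x : prod m) : prod n := fun a => act (W a) f (x a).
Fact dsum_act_proof (x : dsum_at m) : prod_act (val x) \in finsupp (fun a => W a n).
Proof.
have /asboolP xF := valP x; apply/asboolP; apply: sub_finite_set xF => a /=.
by apply: contra_neq => xa0; rewrite /prod_act [val x a]xa0 linear0.
Qed.
Definition dsum_act_fun (x : dsum_at m) : dsum_at n := Subm (dsum_act_proof x).
Fact dsum_act_linear : linear dsum_act_fun.
Proof.
move=> c x y; apply: val_inj; apply: functional_extensionality_dep => a.
exact: (linearP (act (W a) f) c (val x a) (val y a)).
Qed.
Definition dsum_act := mk_linear dsum_act_linear.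
End Act.

Fact dsum_act_id n x : dsum_act (iid n) x = x.
Proof.
by apply: val_inj; apply: functional_extensionality_dep => a; exact: act_id.
Qed.
Fact dsum_act_comp m n p (g : inj n p) (f : inj m n) x :
  dsum_act (icomp g f) x = dsum_act g (dsum_act f x).
Proof.
by apply: val_inj; apply: functional_extensionality_dep => a; exact: act_comp.
Qed.
Definition dsum : cmod := @CMod dsum_at dsum_act dsum_act_id dsum_act_comp.

Section Out.
Variables (V : cmod) (phi : forall a, chom (W a) V).

Definition dsum_out_fun n (x : dsum n) : V n :=
  \sum_(a \in [set: I]) phi a n (val x a).

Lemma dsum_out_finE n (x : dsum n) (D : set I) : finite_set D ->
    (forall a, val x a != 0 -> D a) ->
  dsum_out_fun x = \sum_(a \in D) phi a n (val x a).
Proof.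
move=> Dfin xD; apply/esym/fsbig_widen => // a [_ Da] /=.
have -> : val x a = 0 by apply/eqP/negPn/negP => /xD.
exact: linear0.
Qed.

Fact dsum_out_linear n : linear (@dsum_out_fun n).
Proof.
move=> c x y; have /asboolP xF := valP x; have /asboolP yF := valP y.
set D := ([set a | val x a != 0] `|` [set a | val y a != 0])%classic.
have DF : finite_set D by rewrite finite_setU.
rewrite !(@dsum_out_finE _ _ D) //.
- rewrite !fsbig_finite //= scaler_sumr -big_split /=.
  by apply: eq_bigr => a _; rewrite -linearP.
- by move=> a ya; right.
- by move=> a xa; left.
- move=> a; apply: contra_neqP => /not_orP[/negP/negPn/eqP xa0].
  move=> /negP/negPn/eqP ya0; rewrite [LHS]/(c *: val x a + val y a) xa0 ya0.
  by rewrite scaler0; exact: addr0.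
Qed.

Fact dsum_out_act m n (f : inj m n) (x : dsum m) :
  dsum_out_fun (act dsum f x) = act V f (dsum_out_fun x).
Proof.
have /asboolP xF := valP x; set D := [set a | val x a != 0]%classic in xF.
rewrite !(@dsum_out_finE _ _ D) //.
- rewrite !fsbig_finite //= linear_sum; apply: eq_bigr => a _.
  by rewrite -hom_act.
- move=> a; apply: contra_neqP => /negP/negPn/eqP xa0.
  by rewrite [LHS]/(act (W a) f (val x a)) xa0; exact: linear0.
Qed.

Definition dsum_out : chom dsum V :=
  @CHom dsum V (fun n => mk_linear (@dsum_out_linear n)) dsum_out_act.
End Out.
End DirectSum.

Definition finitely_generated (V : cmod) : Prop :=
  exists (r : nat) (d : 'I_r -> nat)
         (phi : chom (dsum (fun j => principal (d j))) V), chom_surj phi.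

Section Concentrated.
Variable i : nat.

Fact off_closed n :
  subsemimod_closed (fun x : principal i n => (n == i) ==> (x == 0)).
Proof.
split; first split.
- by rewrite unfold_in eqxx implybT.
- move=> x y; rewrite !unfold_in; case: (n == i) => //= /eqP-> /eqP->.
  by rewrite addr0.
- move=> a x; rewrite !unfold_in; case: (n == i) => //= /eqP->.
  by rewrite scaler0.
Qed.

Fact off_act m n (f : inj m n) (x : principal i m) :
  x \in mk_submod (@off_closed m) ->
  act (principal i) f x \in mk_submod (@off_closed n).
Proof.
rewrite !unfold_in => x0; apply/implyP => /eqP ni.
suff -> : x = 0 by rewrite linear0.
move: x0; have [mi /eqP //|mi _] := eqVneq m i.
apply/ffunP => g; have := inj_leq g; have := inj_leq f.
by rewrite ni => mi' im; case/eqP: mi; apply/eqP; rewrite eqn_leq mi' im.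
Qed.
(* The part of C(i,-) in degrees other than i. *)
Definition off : csub (principal i) := CSub off_act.

(* C(i,i), as a module concentrated in degree i. *)
Definition concentrated : cmod := quo_cmod off.
End Concentrated.

Definition td (V : cmod) : \bar int :=
  supremum -oo%E [set i%:Z%:E | i in
    [set i : nat | exists phi : chom (concentrated i) V, hom_nonzero phi]]%classic.

Section H0.
Variable V : cmod.

(* (J V)_n is spanned by the f v with f in C(m,n), m < n, and v in V_m. *)
Definition J_gen n : set (V n) := fun w =>
  exists m (f : inj m n) (v : V m), (m < n)%N /\ act V f v = w.

Fact J_act m n (f : inj m n) v :
  v \in span (@J_gen m) -> act V f v \in span (@J_gen n).
Proof.
apply: span_map => _ [l [g [u [lm <-]]]]; apply: mem_span.
exists l, (icomp f g), u; split; last exact: act_comp.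
exact: leq_trans lm (inj_leq f).
Qed.
Definition J_sub : csub V := CSub J_act.
Definition H0 : cmod := quo_cmod J_sub.
End H0.

Fact H0_map_proof V W (phi : chom V W) n v :
  v \in J_sub V n -> phi n v \in J_sub W n.
Proof.
apply: span_map => _ [m [f [u [mn <-]]]]; apply: mem_span.
by exists m, f, (phi m u); split=> //; rewrite hom_act.
Qed.
Definition H0_map V W (phi : chom V W) : chom (H0 V) (H0 W) :=
  quo_hom (@H0_map_proof V W phi).

(* The free module on all the elements of V, and its map onto V. *)
Definition cover_obj (V : cmod) : cmod :=
  dsum (fun a : {i : nat & V i} => principal (tag a)).
Definition cover_map (V : cmod) : chom (cover_obj V) V :=
  dsum_out (fun a : {i : nat & V i} => yoneda (tagged a)).

Definition syzygy (V : cmod) : cmod := sub_cmod (cker (cover_map V)).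

(* The free resolution ... -> res V 1 -> res V 0 -> V. *)
Definition res (V : cmod) (s : nat) : cmod := cover_obj (iter s syzygy V).
Definition res_d (V : cmod) (s : nat) : chom (res V s.+1) (res V s) :=
  hom_comp (incl (cker (cover_map (iter s syzygy V)))) (cover_map (iter s.+1 syzygy V)).

(* Tor_s(C_0, V), as the homology of H0 applied to the complex res V. *)
Definition homology (s : nat) (V : cmod) : cmod :=
  match s with
  | 0 => quo_cmod (cimg (H0_map (res_d V 0)))
  | s'.+1 => subquo (cimg (H0_map (res_d V s'.+1))) (cker (H0_map (res_d V s')))
  end.

Definition hd (s : nat) (V : cmod) : \bar int := td (homology s V).

(* A kS_i-module: the group S_i is inj i i. *)
Record symmod (i : nat) := SymMod {
  sm_car :> lmodType k;
  sm_act : inj i i -> {linear sm_car -> sm_car};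
  sm_act_id : forall t, sm_act (iid i) t = t;
  sm_act_comp : forall g f t, sm_act (icomp g f) t = sm_act g (sm_act f t) }.

Section Basic.
Variables (i : nat) (T : symmod i).

Definition tensor_rel n : set (ind i T n) := fun x =>
  exists (g : inj i n) (s : inj i i) (t : T),
    x = ind_tensor (icomp g s) t - ind_tensor g (sm_act T s t).

Fact tensor_rel_act m n (f : inj m n) x :
  x \in span (@tensor_rel m) -> act (ind i T) f x \in span (@tensor_rel n).
Proof.
apply: span_map => _ [g [s [t ->]]]; apply: mem_span.
exists (icomp f g), s, t.
by rewrite linearB /= -icompA -!ind_act_tensor.
Qed.

(* C (x)_{kS_i} T, the quotient of C(i,-) (x)_k T by the relations
   (g \o s) (x) t = g (x) (s t). *)
Definition basic_filtered : cmod := quo_cmod (CSub tensor_rel_act).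
End Basic.

Definition is_basic_filtered (W : cmod) : Prop :=
  exists (i : nat) (T : symmod i), cmod_iso W (basic_filtered T).

(* F j is the term V^(j-1) of the filtration. *)
Definition sharp_filtered (V : cmod) : Prop :=
  exists (r : nat) (F : nat -> csub V),
    [/\ forall n v, v \in F 0%N n -> v = 0,
        forall n v, v \in F r.+1 n,
        forall j n v, (j <= r)%N -> v \in F j n -> v \in F j.+1 n &
        forall j, (j <= r)%N -> is_basic_filtered (subquo (F j) (F j.+1))].
End CModules.

(* Main.v *)
From mathcomp Require Import all_boot all_order all_algebra.
From mathcomp Require Import boolp classical_sets cardinality fsbigop.
From mathcomp Require Import constructive_ereal.
Require Import Defs.

Set Implicit Arguments.
Unset Strict Implicit.
Unset Printing Implicit Defensive.

Import Order.TTheory GRing.Theory Num.Theory.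
Local Open Scope ring_scope.

(* Write J_B V for the span in V_n of the images of the injections missing some
   point of B, where B is a set of points of [n]; thus J_[n] V = (J V)_n, and
   V_n / J_B V is an iterated derivative of V. Call V saturated if all iterated
   derivatives are torsion free: if V_n -> V_(n+1) is induced by the inclusion
   missing b, an element whose image lies in J_B V_(n+1), with b not in B, is
   already in J_B V_n. Let 0 -> W -> P -> V -> 0 be exact.
   If V or W is saturated, then W meets J_B P in J_B W for all B; hence
   saturation is inherited by W from P and V, by V from P and W, and by P from
   V and W. If P is saturated and merely H_0 W -> H_0 P is injective, a descent
   on B still gives W :&: J_B P = J_B W, so that V is saturated. As induced
   modules are saturated, H_1 V = 0 if and only if V is saturated, if and only
   if its syzygy is, so that all H_s with s >= 1 vanish simultaneously. Finally,
   the graded pieces of the filtration of a saturated module by generation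
   degree are saturated and generated in a single degree, hence basic. *)

(** * Spans and submodules *)

Lemma span_ind (k : pzRingType) (V : lmodType k) (A : set V) (P : V -> Prop) :
    P 0 -> (forall x y, P x -> P y -> P (x + y)) ->
    (forall c x, P x -> P (c *: x)) -> (forall x, A x -> P x) ->
  forall x, x \in span A -> P x.
Proof.
move=> P0 PD PZ AP x /asboolP xA.
have Pc : subsemimod_closed (fun y : V => `[< P y >]).
  split; first split.
  - exact/asboolP.
  - by move=> u v /asboolP Pu /asboolP Pv; apply/asboolP/PD.
  - by move=> c u /asboolP Pu; apply/asboolP/PZ.
by have /asboolP := xA (mk_submod Pc) (fun a Aa => asboolT (AP a Aa)).
Qed.

Lemma submod_rpredN (k : pzRingType) (V : lmodType k) (S : submodClosed V) x :
  x \in S -> - x \in S.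
Proof. by rewrite -scaleN1r; exact: rpredZ. Qed.

Lemma submod_rpredB (k : pzRingType) (V : lmodType k) (S : submodClosed V) x y :
  x \in S -> y \in S -> x - y \in S.
Proof. by move=> xS yS; rewrite rpredD ?submod_rpredN. Qed.

(** * Cofaces and injections that miss a point *)

Definition coface n (b : 'I_n.+1) : inj n n.+1 := mk_inj (@lift_inj n.+1 b).

Lemma cofaceE n (b : 'I_n.+1) i : coface b i = lift b i.
Proof. exact: mk_injE. Qed.

Definition misses m n (f : inj m n) (B : {set 'I_n}) : Prop :=
  exists2 b, b \in B & forall i, f i != b.

Lemma coface_misses n (b : 'I_n.+1) (B : {set 'I_n.+1}) :
  b \in B -> misses (coface b) B.
Proof. by exists b => // i; rewrite cofaceE eq_sym neq_lift. Qed.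

Lemma misses_coface m n (f : inj m n.+1) (b : 'I_n.+1) :
  (forall i, f i != b) -> exists g : inj m n, f = icomp (coface b) g.
Proof.
move=> fb.
have [i|g gE] := @boolp.choice 'I_m 'I_n (fun i j => f i = lift b j).
  case: (unliftP b (f i)) => [j ->|/eqP]; first by exists j.
  by rewrite (negPf (fb i)).
have gI : injective g by move=> i j ij; apply: (@inj_inj _ _ f); rewrite !gE ij.
by exists (mk_inj gI); apply: injP => i; rewrite mk_injE /= cofaceE mk_injE.
Qed.

Lemma imset_liftK n (b : 'I_n.+1) (B : {set 'I_n.+1}) :
  b \notin B -> lift b @: (lift b @^-1: B) = B.
Proof.
move=> bB; apply/setP => c; apply/imsetP/idP => [[a]|cB].
  by rewrite inE => aB ->.
case: (unliftP b c) => [a ca|cb]; last by rewrite -cb cB in bB.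
by exists a; rewrite // inE -ca.
Qed.

(** * The submodules J_B V *)

Section Deficient.
Variable k : comPzRingType.
Implicit Types V W : cmod k.

Definition deficient_gen V n (B : {set 'I_n}) : set (V n) := fun w =>
  exists m (f : inj m n) (v : V m), misses f B /\ act V f v = w.

Definition deficient V n (B : {set 'I_n}) : submodClosed (V n) :=
  span (@deficient_gen V n B).

Lemma deficient_act V m n (f : inj m n) (B : {set 'I_n}) v :
  misses f B -> act V f v \in deficient V B.
Proof. by move=> fB; apply: mem_span; exists m, f, v. Qed.

Lemma deficientS V n (B B' : {set 'I_n}) x :
  B \subset B' -> x \in deficient V B -> x \in deficient V B'.
Proof.
move=> /fintype.subsetP BB'.
apply: (@span_map _ _ _ _ _ (idfun : {linear V n -> V n})).
move=> _ [m [f [v [[b bB fb] <-]]]]; apply: deficient_act.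
by exists b => //; exact: BB'.
Qed.

Lemma act_deficient V m n (f : inj m n) (B : {set 'I_m}) x :
  x \in deficient V B -> act V f x \in deficient V (f @: B).
Proof.
apply: span_map => _ [l [g [v [[b bB gb] <-]]]]; rewrite -act_comp.
apply: deficient_act; exists (f b); first exact: imset_f.
by move=> i; rewrite mk_injE /= (inj_eq (@inj_inj _ _ f)).
Qed.

Lemma hom_deficient V W (phi : chom V W) n (B : {set 'I_n}) x :
  x \in deficient V B -> phi n x \in deficient W B.
Proof.
apply: (@span_map _ _ _ _ _ (phi n)) => _ [l [g [v [gB <-]]]].
rewrite hom_act; exact: deficient_act.
Qed.

Lemma lift_deficient V W (phi : chom V W) n (B : {set 'I_n}) y :
    chom_surj phi -> y \in deficient W B ->
  exists2 x, x \in deficient V B & phi n x = y.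
Proof.
move=> phiS; move: y; apply: span_ind.
- by exists 0; rewrite ?rpred0 ?linear0.
- by move=> _ _ [u uB <-] [v vB <-]; exists (u + v); rewrite ?rpredD ?linearD.
- by move=> c _ [u uB <-]; exists (c *: u); rewrite ?rpredZ ?linearZ.
- move=> _ [m [f [w [fB <-]]]]; have [v <-] := phiS _ w.
  by exists (act V f v); rewrite ?hom_act ?deficient_act.
Qed.

Lemma deficient0 V n x : x \in deficient V (finset.set0 : {set 'I_n}) -> x = 0.
Proof.
move: x; apply: span_ind.
- by [].
- by move=> x y -> ->; rewrite addr0.
- by move=> c x ->; rewrite scaler0.
- by move=> z [m [f [v [[b]]]]]; rewrite inE.
Qed.

(** A generator missing [b] factors through [coface b] and feeds [p]; any other misses a point of
    [B] and feeds [z]. Inductions on [B] rest on this. *)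
Lemma deficientU1 V n (b : 'I_n.+1) (B : {set 'I_n.+1}) x :
    x \in deficient V (b |: B) ->
  exists (p : V n) (z : V n.+1), z \in deficient V B /\
    x = act V (coface b) p + z.
Proof.
move: x; apply: span_ind.
- by exists 0, 0; rewrite rpred0 linear0 addr0.
- move=> _ _ [p [z [zB ->]]] [p' [z' [zB' ->]]].
  by exists (p + p'), (z + z'); rewrite rpredD // linearD addrACA.
- move=> c _ [p [z [zB ->]]].
  by exists (c *: p), (c *: z); rewrite rpredZ // linearZ scalerDr.
- move=> _ [m [f [v [[c cB fc] <-]]]].
  have [cb|cb] := eqVneq c b.
    rewrite cb in fc; have [g ->] := misses_coface fc.
    by exists (act V g v), 0; rewrite rpred0 addr0 act_comp.
  exists 0, (act V f v); rewrite linear0 add0r deficient_act //.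
  by exists c => //; move: cB; rewrite !inE (negPf cb).
Qed.

(** An injection from [m] to [n] misses a point exactly when m < n. *)
Lemma deficientT V n x : (x \in deficient V [set: 'I_n]) = (x \in J_sub V n).
Proof.
apply/idP/idP; apply: (@span_map _ _ _ _ _ (idfun : {linear V n -> V n})).
  move=> _ [m [f [v [[b _ fb] <-]]]]; apply: mem_span; exists m, f, v; split=> //.
  have /subset_leq_card : codom f \subset predC1 b.
    by apply/fintype.subsetP => _ /codomP[i ->]; exact: fb.
  rewrite cardC1 card_codom ?card_ord; last exact: inj_inj.
  by rewrite -ltnS prednK // (leq_ltn_trans _ (ltn_ord b)).
move=> _ [m [f [v [mn <-]]]]; apply: deficient_act.
have [b bf] : exists b, b \notin codom f.
  apply/existsP; rewrite -negb_forall; apply/negP => /forallP fS.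
  have : (#|'I_n| <= #|[in codom f]|)%N.
    by apply/subset_leq_card/fintype.subsetP => b _; exact: fS.
  rewrite card_codom; last exact: inj_inj.
  by rewrite !card_ord leqNgt mn.
by exists b => // i; apply: contraNneq bf => <-; exact: codom_f.
Qed.
End Deficient.

Opaque deficient.

(** * Saturation and purity in exact sequences *)

Section Saturated.
Variable k : comPzRingType.
Implicit Types V W : cmod k.

(* All iterated derivatives of V are torsion free: the derivative of order #|B|
   along the points of B is V n / deficient V B. *)
Definition saturated V : Prop :=
  forall n (b : 'I_n.+1) (B : {set 'I_n}) (x : V n),
    act V (coface b) x \in deficient V (lift b @: B) -> x \in deficient V B.

Definition chom_inj V W (phi : chom V W) : Prop := forall n, injective (phi n).

(** Injectivity of the maps induced by [phi] on all iterated derivatives. *)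
Definition pure V W (phi : chom V W) : Prop :=
  forall n (B : {set 'I_n}) (x : V n),
    phi n x \in deficient W B -> x \in deficient V B.

(* Injectivity of H0 phi. *)
Definition pureT V W (phi : chom V W) : Prop :=
  forall n (x : V n),
    phi n x \in deficient W [set: 'I_n] -> x \in deficient V [set: 'I_n].

Definition exact_at U V W (i : chom U V) (q : chom V W) : Prop :=
  forall n (x : V n), q n x = 0 <-> exists u, i n u = x.

Lemma coface_imset_deficient V n (b : 'I_n.+1) (B : {set 'I_n}) x :
  x \in deficient V B -> act V (coface b) x \in deficient V (lift b @: B).
Proof.
move=> /(act_deficient (coface b)); rewrite (_ : coface b @: B = lift b @: B) //.
by apply: eq_imset => i; exact: cofaceE.
Qed.

Lemma finset_ind n (P : {set 'I_n} -> Prop) : P finset.set0 ->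
    (forall (b : 'I_n) (B : {set 'I_n}), b \notin B -> P B -> P (b |: B)) ->
  forall B, P B.
Proof.
move=> P0 PU B; have [m] := ubnP #|B|; elim: m B => // m IH B Bm.
have [->//|/set0Pn[b bB]] := eqVneq B finset.set0.
rewrite -(finset.setD1K bB); apply: PU; first by rewrite !inE eqxx.
by apply: IH; move: Bm; rewrite (cardsD1 b) bB ltnS.
Qed.

(** The map compared with [coface ord_max] in [saturated_pure]; the two differ at [b] only. *)
Definition redirect_fun n (b : 'I_n.+1) (c : 'I_n.+1) : 'I_n.+2 :=
  if c == b then ord_max else lift ord_max c.

Lemma redirect_inj n (b : 'I_n.+1) : injective (redirect_fun b).
Proof.
move=> c c'; rewrite /redirect_fun.
case: (eqVneq c b) => [->|_]; case: (eqVneq c' b) => [->|_] //.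
- by move=> /eqP; rewrite (negPf (neq_lift _ _)).
- by move=> /eqP; rewrite eq_sym (negPf (neq_lift _ _)).
- exact: lift_inj.
Qed.

Definition redirect n (b : 'I_n.+1) : inj n.+1 n.+2 := mk_inj (@redirect_inj n b).

Lemma redirect_coface n (b : 'I_n.+1) :
  icomp (redirect b) (coface b) = icomp (coface ord_max) (coface b).
Proof.
apply: injP => i; rewrite !mk_injE /= !mk_injE /redirect_fun.
by rewrite eq_sym (negPf (neq_lift _ _)).
Qed.

(* If i x = b p + z with z deficient, then i x has the same image, modulo
   deficient elements, under the inclusion of [n] in [n+1] and under the map
   sending b to the new point; the latter image comes from a map missing b. *)
Lemma saturated_pure V W (i : chom V W) :
  saturated V -> chom_inj i -> pure i.
Proof.
(* The induction hypothesis is used one degree up, so [n] stays general while the size of [B]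
   drops. *)
move=> Vs iI n B; have [m] := ubnP #|B|; elim: m n B => // m IH n B Bm x.
have [->|/set0Pn[b bB]] := eqVneq B finset.set0.
  move=> /deficient0 ix; suff -> : x = 0 by rewrite rpred0.
  by apply: iI; rewrite ix linear0.
case: n b B x Bm bB => [[]//|n] b B x Bm bB.
set B' := B :\ b; have BE : B = b |: B' by rewrite finset.setD1K.
have bB' : b \notin B' by rewrite !inE eqxx.
rewrite {1}BE => /deficientU1[p [z [zB' ixE]]].
pose e := coface (@ord_max n.+1); pose e' := redirect b.
(* As [b] is not in [B'], both images of [z] are deficient along one and the same set. *)
have e'B' : e' @: B' = e @: B'.
  apply: eq_in_imset => c cB'; rewrite mk_injE cofaceE /redirect_fun.
  by case: eqP cB' => [->|//]; rewrite (negPf bB').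
have dB : act V e x - act V e' x \in deficient V (e @: B').
  apply: IH.
    by rewrite card_imset; [move: Bm; rewrite (cardsD1 b) bB ltnS|exact: inj_inj].
  rewrite linearB /= !hom_act ixE !linearD /= -!act_comp redirect_coface.
  rewrite addrACA subrr add0r submod_rpredB //; first exact: act_deficient.
  by rewrite -e'B'; exact: act_deficient.
apply: (Vs _ ord_max); rewrite -[act V _ x](subrK (act V e' x)).
have eE : lift ord_max @: B = e @: B.
  by apply: eq_imset => c; rewrite cofaceE.
rewrite eE rpredD //.
  by apply: deficientS dB; apply/finset.imsetS/finset.subD1set.
apply: deficient_act; exists (e b); first exact: imset_f.
move=> c; rewrite mk_injE cofaceE /redirect_fun; case: (eqVneq c b) => [_|cb].
  exact: neq_lift.
by rewrite (inj_eq lift_inj).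
Qed.

Section Exact.
Variables (A V C : cmod k) (i : chom A V) (q : chom V C).
Hypotheses (iI : chom_inj i) (qS : chom_surj q) (iq : exact_at i q).

Let qi n a : q n (i n a) = 0.
Proof. by apply/iq; exists a. Qed.

Let qP n (x y : V n) : q n x = q n y -> exists a, x = i n a + y.
Proof.
move=> xy; have [|a aE] := (iq (x - y)).1; first by rewrite linearB /= xy subrr.
by exists a; rewrite aE subrK.
Qed.

(** Write i x = b p + z. In [C], b (q p) = - q z is deficient along [B], so saturation makes q p
    deficient; lifting gives p = i a + p' with [p'] deficient. Then x - b a has image b p' + z, and
    the induction on [B] applies to it. *)
Lemma saturated_cokernel_pure : saturated C -> pure i.
Proof.
move=> Cs n; elim/finset_ind=> [|b B bB IH] x.
  move=> /deficient0 ix; suff -> : x = 0 by rewrite rpred0.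
  by apply: iI; rewrite ix linear0.
case: n b B bB IH x => [[]//|n] b B bB IH x /deficientU1[p [z [zB ixE]]].
have : q n p \in deficient C (lift b @^-1: B).
  apply: (Cs _ b); rewrite imset_liftK // -hom_act.
  rewrite (_ : act V _ p = i _ x - z); last by rewrite ixE addrK.
  by rewrite linearB /= qi sub0r submod_rpredN //; exact: hom_deficient.
case/(lift_deficient qS) => p' p'B /esym/qP[a pE].
have xB : x - act A (coface b) a \in deficient A B.
  apply: IH; rewrite linearB /= hom_act ixE pE linearD /= addrAC addrC.
  rewrite addrAC subrr add0r rpredD //.
  by rewrite -(imset_liftK bB); exact: coface_imset_deficient.
rewrite -(subrK (act A (coface b) a) x) rpredD //.
  by apply: deficientS xB; exact: finset.subsetU1.
by apply/deficient_act/coface_misses/finset.setU11.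
Qed.

Lemma saturated_kernel : pure i -> saturated V -> saturated A.
Proof.
move=> ip Vs n b B x xB; apply/ip/(Vs _ b); rewrite -hom_act.
exact: hom_deficient.
Qed.

(** If b x = i a + y with [y] deficient, then i a is deficient along the image of [B] enlarged by
    [b], so purity gives a = b a' + z. Now b (x - i a') = y + i z is deficient, and x - i a' has the
    same image in [C] as [x]. *)
Lemma saturated_cokernel : pure i -> saturated V -> saturated C.
Proof.
move=> ip Vs n b B c; have [x <-] := qS c; rewrite -hom_act.
case/(lift_deficient qS) => y yB /esym/qP[a xE].
have : a \in deficient A (b |: lift b @: B).
  apply: ip; rewrite -[i _ a](addrK y) -xE submod_rpredB //.
    by apply/deficient_act/coface_misses/finset.setU11.
  by apply: deficientS yB; exact: finset.subsetU1.
case/deficientU1 => a' [z [zB aE]].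
rewrite -[x](subrK (i n a')) linearD /= qi addr0; apply: hom_deficient.
apply: (Vs _ b); rewrite linearB /= xE aE linearD /= hom_act.
rewrite addrC !addrA addNr add0r rpredD //; exact: hom_deficient.
Qed.

(** Subtracting a deficient lift of q x leaves an element coming from [A]. *)
Lemma saturated_extension : saturated A -> saturated C -> saturated V.
Proof.
move=> As Cs n b B x xB; have ip := saturated_cokernel_pure Cs.
have : q n x \in deficient C B.
  by apply: (Cs _ b); rewrite -hom_act; exact: hom_deficient.
case/(lift_deficient qS) => y yB /esym/qP[a xE].
rewrite xE rpredD //; apply/hom_deficient/(As _ b)/ip; rewrite hom_act.
rewrite -[act V _ _](addrK (act V (coface b) y)) -linearD /= -xE submod_rpredB //.
exact: coface_imset_deficient.
Qed.

(* Starting from the full set, the points outside B are removed one at a time;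
   saturation of V carries each removal down to a smaller degree. *)
Lemma pureT_pure : pureT i -> saturated V -> pure i.
Proof.
move=> iT Vs n; have [m] := ubnP n; elim: m n => // m IH n nm B x ixB.
suff H D : x \in deficient A (B :|: D) -> x \in deficient A B.
  apply: (H [set: 'I_n]); rewrite finset.setUT.
  exact/iT/(deficientS _ ixB)/finset.subsetT.
elim/finset_ind: D => [|b D bD IHD]; first by rewrite finset.setU0.
rewrite finset.setUCA; pose S := B :|: D; rewrite -/S.
have [bS|bS] := boolP (b \in S).
  by rewrite (_ : b |: S = S) //; apply/finset.setUidPr; rewrite finset.sub1set.
have BS : B \subset S by exact: finset.subsetUl.
move: S bS BS (IHD : x \in deficient A S -> _) => S bS BS {D bD} IHD.
case: n b S B x bS BS IH nm ixB IHD => [[]//|n] b S B x bS BS IH nm ixB IHD.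
case/deficientU1=> w [z [zS xE]]; apply: IHD; rewrite xE rpredD //.
rewrite -(imset_liftK bS); apply: coface_imset_deficient.
(* [w] lives one degree lower, and b (i w) = i (x - z) is deficient along [S]; saturation passes
   this on to i w. *)
apply: IH => //; apply: (Vs _ b); rewrite imset_liftK // -hom_act.
have -> : act A (coface b) w = x - z by rewrite xE addrK.
rewrite linearB /= submod_rpredB //.
  exact: deficientS ixB.
exact: hom_deficient.
Qed.
End Exact.
End Saturated.

(** * Quotients, induced modules and basic modules *)

Section QuotientProjection.
Variables (k : comPzRingType) (V : cmod k) (S : csub V).

Fact quo_pi_act m n (f : inj m n) (v : V m) :
  mk_linear (@quom_pi_linear k (V n) (S n)) (act V f v) =
  act (quo_cmod S) f (mk_linear (@quom_pi_linear k (V m) (S m)) v).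
Proof. by rewrite [RHS](quom_map_pi (@cs_act k V S _ _ _)). Qed.
Definition quo_pi : chom V (quo_cmod S) :=
  @CHom k V (quo_cmod S)
    (fun n => mk_linear (@quom_pi_linear k (V n) (S n))) quo_pi_act.

Lemma quo_pi_surj : chom_surj quo_pi.
Proof. by move=> n w; exists (quom_repr w); exact: quom_reprK. Qed.

Lemma quo_pi_eq n (x y : V n) : quo_pi n x = quo_pi n y <-> x - y \in S n.
Proof. exact: quom_eq. Qed.

Lemma quo_pi_eq0 n (x : V n) : quo_pi n x = 0 <-> x \in S n.
Proof. by rewrite -[0](linear0 (quo_pi n)) quo_pi_eq subr0. Qed.

End QuotientProjection.

Section Induced.
Variables (k : comPzRingType) (i : nat) (T : lmodType k).

Lemma ind_sum_tensor n (x : ind i T n) : x = \sum_g ind_tensor g (x g).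
Proof.
apply/ffunP => h; rewrite sum_ffunE (bigD1 h) //= ffunE eqxx big1 ?addr0 //.
by move=> g /negPf gh; rewrite ffunE eq_sym gh.
Qed.

Lemma mem_deficient_ind n (B : {set 'I_n}) (x : ind i T n) :
  (forall g, x g <> 0 -> misses g B) -> x \in deficient (ind i T) B.
Proof.
move=> xB; rewrite (ind_sum_tensor x); apply: rpred_sum => g _.
have [xg0|/eqP/xB gB] := eqVneq (x g) 0.
  rewrite (_ : ind_tensor _ _ = 0) ?rpred0 //.
  by apply/ffunP => h; rewrite !ffunE xg0 if_same.
by rewrite -[g]icompf1 -ind_act_tensor; exact: deficient_act.
Qed.

Section Retract.
Variables (n : nat) (b : 'I_n.+1).

(** Keeps the coefficients of the injections missing [b] and drops the others. It inverts
    [act (coface b)] on the left and respects J_B, whence saturation. *)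
Definition ind_retract_fun (x : ind i T n.+1) : ind i T n :=
  [ffun g => x (icomp (coface b) g)].
Fact ind_retract_linear : linear ind_retract_fun.
Proof. by move=> a x y; apply/ffunP => g; rewrite !ffunE. Qed.
Definition ind_retract := mk_linear ind_retract_linear.

Lemma icomp_coface_inj m : injective (@icomp m _ _ (coface b)).
Proof.
move=> g h gh; apply: injP => j; have /(congr1 (fun f : inj m n.+1 => f j)) := gh.
by rewrite !mk_injE; exact: inj_inj.
Qed.

Lemma ind_retract_act x : ind_retract (act (ind i T) (coface b) x) = x.
Proof.
apply/ffunP => g; rewrite !ffunE (big_pred1 g) // => h.
by rewrite (inj_eq (@icomp_coface_inj _)).
Qed.

(** The image of [f] is supported on injections factoring through [f], which miss whatever [f]
    misses. *)
Lemma ind_retract_deficient (B : {set 'I_n}) x :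
  x \in deficient (ind i T) (lift b @: B) ->
  ind_retract x \in deficient (ind i T) B.
Proof.
apply: (@span_map _ _ _ _ _ ind_retract).
move=> _ [m [f [v [[_ /imsetP[c cB ->] fc] <-]]]].
apply: mem_deficient_ind => g; rewrite !ffunE => vN0.
exists c => // j; apply/negP => /eqP gj; apply: vN0.
rewrite big1 // => h /eqP fh; have /eqP[] := fc (inj_fun h j).
have /(congr1 (fun f : inj i n.+1 => f j)) := fh.
by rewrite !mk_injE /= cofaceE gj.
Qed.
End Retract.

Lemma saturated_ind : saturated (ind i T).
Proof. by move=> n b B x /ind_retract_deficient; rewrite ind_retract_act. Qed.

Lemma saturated_ind_quo (S : csub (ind i T)) :
    (forall n (b : 'I_n.+1) x, x \in S n.+1 -> ind_retract b x \in S n) ->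
  saturated (quo_cmod S).
Proof.
move=> Sr n b B y; have [x <-] := quo_pi_surj y; rewrite -hom_act.
case/(lift_deficient (@quo_pi_surj _ _ S)) => z zB /esym/quo_pi_eq/(Sr _ b).
rewrite linearB [X in X - _]ind_retract_act.
by move=> /quo_pi_eq ->; apply: hom_deficient; exact: ind_retract_deficient.
Qed.
End Induced.

(** An injection and its composite with a permutation have the same image: if it omits [b], the
    retraction sends the relation to a relation, otherwise to 0. *)
Lemma saturated_basic (k : comPzRingType) i (T : symmod k i) :
  saturated (basic_filtered T).
Proof.
apply: saturated_ind_quo => n b x.
change (x \in span (@tensor_rel k i T n.+1) ->
  ind_retract i T b x \in span (@tensor_rel k i T n)).
apply: (@span_map _ _ _ _ _ (ind_retract i T b)) => _ [g [s [t ->]]].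
have [gb|] := boolP [forall j, g j != b].
  have [h ->] := misses_coface (fun j => forallP gb j).
  apply: mem_span; exists h, s, t; apply/ffunP => f; rewrite !ffunE -icompA.
  by rewrite !(inj_eq (@icomp_coface_inj _ _ _)).
rewrite negb_forall => /existsP[j]; rewrite negbK => /eqP gj.
rewrite (_ : ind_retract i T b _ = 0) ?rpred0 //; apply/ffunP => f; rewrite !ffunE.
have off (h : inj i n) (g' : inj i n.+1) l :
    g' l = b -> icomp (coface b) h == g' = false.
  move=> g'l; apply/eqP => /(congr1 (fun f : inj i n.+1 => f l)).
  rewrite mk_injE /= cofaceE g'l => /eqP.
  by rewrite eq_sym (negPf (neq_lift _ _)).
(* [s] is bijective, so [icomp g s] attains [b] too, at [s' j]. *)
have [s' _ s'K] := injF_bij (@inj_inj _ _ s).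
by rewrite (off _ g j) // (off _ (icomp g s) (s' j)) ?subr0 // mk_injE /= s'K.
Qed.

(** * Direct sums and the free cover *)

Section DirectSumInjection.
Variables (k : comPzRingType) (I : choiceType) (W : I -> cmod k).

Section Injection.
Variable a : I.

Definition dsum_in_fun n (w : W a n) : dprod (fun b => W b n) :=
  dfwith (fun b => 0 : W b n) w.

Lemma dsum_in_finsupp n (w : W a n) : dsum_in_fun w \in finsupp (fun b => W b n).
Proof.
apply/asboolP; apply: (@sub_finite_set _ _ [set a]%classic) => // b /= wb.
apply: contra_neqP wb => /eqP ba; rewrite /dsum_in_fun dfwith_out //.
by rewrite eq_sym.
Qed.

Fact dsum_in_linear n :
  linear (fun w : W a n => Subm (dsum_in_finsupp w) : dsum W n).
Proof.
move=> c u v; apply: val_inj; apply: functional_extensionality_dep => b.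
rewrite [RHS]/(c *: dsum_in_fun u b + dsum_in_fun v b) /= /dsum_in_fun.
have [<-|ab] := eqVneq a b; first by rewrite !dfwith_in.
by rewrite !dfwith_out // scaler0; exact: (esym (addr0 _)).
Qed.

Fact dsum_in_act m n (f : inj m n) w :
  mk_linear (@dsum_in_linear n) (act (W a) f w) =
  act (dsum W) f (mk_linear (@dsum_in_linear m) w).
Proof.
apply: val_inj; apply: functional_extensionality_dep => b.
rewrite [RHS]/(act (W b) f (dsum_in_fun w b)) /= /dsum_in_fun.
have [<-|ab] := eqVneq a b; first by rewrite !dfwith_in.
by rewrite !dfwith_out //; exact: (esym (linear0 _)).
Qed.
Definition dsum_in : chom (W a) (dsum W) :=
  @CHom k (W a) (dsum W) (fun n => mk_linear (@dsum_in_linear n)) dsum_in_act.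

Fact dsum_at_linear n : linear (fun x : dsum W n => val x a).
Proof. by []. Qed.
Definition dsum_proj : chom (dsum W) (W a) :=
  @CHom k (dsum W) (W a) (fun n => mk_linear (@dsum_at_linear n))
    (fun m n f x => erefl).

Lemma dsum_in_same n (w : W a n) : val (dsum_in n w) a = w.
Proof. exact: dfwith_in. Qed.

Lemma dsum_in_other n (w : W a n) b : a != b -> val (dsum_in n w) b = 0.
Proof. exact: dfwith_out. Qed.
End Injection.

(** [x] is the finite sum of its components; the induction runs along a list containing its
    support. *)
Lemma dsum_mem n (S : submodClosed (dsum W n)) (x : dsum W n) :
  (forall a, dsum_in a n (val x a) \in S) -> x \in S.
Proof.
have /asboolP/finite_seqP[s xs] := valP x.
have {xs} : forall a, a \notin s -> val x a = 0.
  move=> a; apply: contraNeq => xa.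
  by have : [set` s]%classic a by rewrite -xs.
elim: s x => [|a s IH] x xs xS.
  rewrite (_ : x = 0) ?rpred0 //; apply: val_inj.
  by apply: functional_extensionality_dep => b; exact: xs.
have xB b : val (x - dsum_in a n (val x a)) b =
    val x b - val (dsum_in a n (val x a)) b :> W b n.
  exact: (linearB (dsum_proj b n)).
rewrite -(subrK (dsum_in a n (val x a)) x) rpredD //.
apply: IH => b => [bs|]; rewrite xB; have [<-|ab] := eqVneq a b.
- by rewrite dsum_in_same subrr.
- by rewrite dsum_in_other // subr0 xs // inE negb_or eq_sym ab.
- by rewrite dsum_in_same subrr linear0 rpred0.
- by rewrite dsum_in_other // subr0.
Qed.

Lemma saturated_dsum : (forall a, saturated (W a)) -> saturated (dsum W).
Proof.
move=> Ws n b B x xB; apply: dsum_mem => a; apply: hom_deficient.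
by apply: (Ws a n b); exact: (hom_deficient (dsum_proj a) xB).
Qed.
End DirectSumInjection.

Section Cover.
Variables (k : comPzRingType) (V : cmod k).

Lemma dsum_out_in (I : choiceType) (W : I -> cmod k)
    (phi : forall a, chom (W a) V) a n (w : W a n) :
  dsum_out phi n (dsum_in W a n w) = phi a n w.
Proof.
rewrite [LHS](@dsum_out_finE _ _ _ _ phi _ _ [set a]%classic) //.
  by rewrite fsbig_set1 dsum_in_same.
move=> b; apply: contra_neqP => /eqP ba; rewrite dsum_in_other //.
by rewrite eq_sym.
Qed.

Lemma yoneda_id n (v : V n) : yoneda v n (@ind_tensor k n k^o n (iid n) 1) = v.
Proof.
rewrite [LHS]/(yoneda_fun _ _) /yoneda_fun (bigD1 (iid n)) //= ffunE eqxx.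
rewrite act_id scale1r big1 ?addr0 // => f /negPf fi.
by rewrite ffunE fi scale0r.
Qed.

Lemma cover_map_surj : chom_surj (cover_map V).
Proof.
move=> n v; exists (dsum_in (fun a : {i : nat & V i} => principal k (tag a))
  (Tagged (fun i => V i) v) n (@ind_tensor k n k^o n (iid n) 1)).
by rewrite dsum_out_in; exact: yoneda_id.
Qed.

Lemma saturated_cover : saturated (cover_obj V).
Proof. by apply: saturated_dsum => a; exact: saturated_ind. Qed.
End Cover.

Lemma incl_inj (k : comPzRingType) (V : cmod k) (S : csub V) : chom_inj (incl S).
Proof. by move=> n; exact: val_inj. Qed.

Lemma cker_exact (k : comPzRingType) (V W : cmod k) (q : chom V W) :
  exact_at (incl (cker q)) q.
Proof.
move=> n x; split=> [/eqP xK|[u <-]]; last first.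
  by apply/eqP; exact: (valP u).
by exists (Subm (xK : x \in cker q n)).
Qed.

(** Either way the inclusion of the syzygy in the cover is pure: by [saturated_pure] if the syzygy
    is saturated, by [saturated_cokernel_pure] if [V] is. *)
Lemma saturated_syzygy (k : comPzRingType) (V : cmod k) :
  saturated (syzygy V) <-> saturated V.
Proof.
have sP := @saturated_cover k V.
have iI := @incl_inj _ _ (cker (cover_map V)).
have iq := cker_exact (cover_map V); have qS := @cover_map_surj _ V.
split=> Vs.
  exact: (saturated_cokernel qS iq (saturated_pure Vs iI)).
exact: (saturated_kernel (saturated_cokernel_pure iI qS iq Vs)).
Qed.

(** The left side amounts to the vanishing of H_1, by [homology_vanishes]; [pureT_pure] upgrades it
    to purity. *)
Lemma saturated_syzygy_pureT (k : comPzRingType) (V : cmod k) :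
  pureT (incl (cker (cover_map V))) <-> saturated V.
Proof.
have sP := @saturated_cover k V.
have iI := @incl_inj _ _ (cker (cover_map V)).
have iq := cker_exact (cover_map V); have qS := @cover_map_surj _ V.
split=> [iT|Vs].
  exact: (saturated_cokernel qS iq (pureT_pure iT sP)).
by move=> n x; exact: (saturated_cokernel_pure iI qS iq Vs).
Qed.

(** * Descent to quotients and torsion degree *)

Section QuotientDescent.
Variables (k : comPzRingType) (V W : cmod k) (S : csub V) (phi : chom V W).
Hypothesis phiS : forall n v, v \in S n -> phi n v = 0.

Definition quo_desc_fun n (x : quo_cmod S n) : W n := phi n (quom_repr x).

Lemma quo_desc_pi n x : quo_desc_fun (quo_pi S n x) = phi n x.
Proof.
apply/eqP; rewrite -subr_eq0 -linearB; apply/eqP/phiS.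
exact: quom_pi_repr.
Qed.

Fact quo_desc_linear n : linear (@quo_desc_fun n).
Proof.
move=> a x y; have [u <-] := quo_pi_surj x; have [v <-] := quo_pi_surj y.
by rewrite -linearP !quo_desc_pi linearP.
Qed.

Fact quo_desc_act m n (f : inj m n) x :
  mk_linear (@quo_desc_linear n) (act (quo_cmod S) f x) =
  act W f (mk_linear (@quo_desc_linear m) x).
Proof.
have [u <-] := quo_pi_surj x.
rewrite -hom_act [LHS]quo_desc_pi hom_act; apply: congr1.
exact: (esym (quo_desc_pi u)).
Qed.

Definition quo_desc : chom (quo_cmod S) W :=
  @CHom k (quo_cmod S) W (fun n => mk_linear (@quo_desc_linear n)) quo_desc_act.

Lemma quo_descE n x : quo_desc n (quo_pi S n x) = phi n x.
Proof. exact: quo_desc_pi. Qed.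
End QuotientDescent.

Section TorsionDegree.
Variable k : comPzRingType.

(** [supremum] falls back on its default [-oo] when no least upper bound exists, so one is
    exhibited: the maximum if [A] is bounded, [+oo] otherwise. *)
Lemma supremum_ninfty (A : set nat) :
  supremum -oo%E [set i%:Z%:E | i in A]%classic = -oo%E -> forall i, ~ A i.
Proof.
move=> supA i Ai; set E := [set _ | _ in A]%classic in supA.
have Ei : E i%:Z%:E by exists i.
suff /ge_supremum_Nmem/(_ Ei) : (supremums E !=set0)%classic.
  by move=> /(_ -oo%E); rewrite supA leeNy_eq.
have [[N NA]|unb] := pselect (exists N, forall j, A j -> (j <= N)%N).
  have exA : exists j, `[< A j >] by exists i; apply/asboolP.
  have ubA j : `[< A j >] -> (j <= N)%N by move=> /asboolP/NA.
  have [m /asboolP Am mA] := ex_maxnP exA ubA.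
  exists m%:Z%:E; split; last by move=> y; apply; exists m.
  by move=> _ [j Aj <-]; rewrite lee_fin lez_nat; apply/mA/asboolP.
exists +oo%E; split; first by move=> y _; exact: leey.
move=> [r| |] yE //; last by have := yE _ Ei; rewrite leeNy_eq.
exfalso; apply: unb; exists `|r|%N => j Aj.
have : (j%:Z%:E <= r%:E :> \bar int)%E by apply: yE; exists j.
by rewrite lee_fin -lez_nat => /le_trans; apply; rewrite abszE ler_norm.
Qed.

Definition trivial_action (V : cmod k) : Prop :=
  forall m n (f : inj m n) (v : V m), (m < n)%N -> act V f v = 0.

Definition vanishes (V : cmod k) : Prop := forall n (v : V n), v = 0.

(** As maps raising the degree act by zero, [yoneda v] kills [off] and factors through
    [concentrated i]; it is nonzero when [v] is. *)
Lemma td_ninfty V : trivial_action V -> (td V = -oo%E <-> vanishes V).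
Proof.
move=> V0; split=> [/supremum_ninfty tdV i v|Vv]; last first.
  rewrite /td [X in supremum _ X](_ : _ = classical_sets.set0) ?supremum0 //.
  by rewrite -subset0 => y [i [phi [n [v phiv]]]]; case: phiv; exact: Vv.
have offv n x : x \in off k i n -> yoneda v n x = 0.
  rewrite unfold_in; case: (eqVneq n i) => /= [_ /eqP->|ni _].
    exact: (linear0 (yoneda v n)).
  rewrite [LHS]big1 // => f _; rewrite V0 ?scaler0 //.
  by rewrite ltn_neqAle eq_sym ni inj_leq.
apply: contrapT => v0; apply: (tdV i); exists (quo_desc offv).
exists i, (quo_pi _ i (@ind_tensor k i k^o i (iid i) 1)).
by rewrite quo_descE yoneda_id.
Qed.
End TorsionDegree.

(** * Vanishing of homology and saturation *)

Section Homology.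
Variable k : comPzRingType.
Implicit Types V W : cmod k.

Lemma trivial_sub V (S : csub V) : trivial_action V -> trivial_action (sub_cmod S).
Proof. by move=> V0 m n f v mn; apply: val_inj; exact: V0. Qed.

Lemma trivial_quo V (S : csub V) : trivial_action V -> trivial_action (quo_cmod S).
Proof.
move=> V0 m n f v mn; have [u <-] := quo_pi_surj v.
by rewrite -hom_act V0 // linear0.
Qed.

Lemma trivial_H0 V : trivial_action (H0 V).
Proof.
move=> m n f v mn; have [u <-] := quo_pi_surj v.
rewrite -hom_act; apply/quo_pi_eq0/mem_span.
by exists m, f, u.
Qed.

Lemma subquo_vanishes V (A B : csub V) :
  vanishes (subquo A B) <-> forall n v, v \in B n -> v \in A n.
Proof.
split=> [AB n v vB|BA n x].
  by have /quo_pi_eq0 := AB n (quo_pi (cpreim (incl B) A) n (Subm vB)).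
by have [u <-] := quo_pi_surj x; apply/quo_pi_eq0/BA/valP.
Qed.

Lemma H0_map_pi V W (phi : chom V W) n v :
  H0_map phi n (quo_pi (J_sub V) n v) = quo_pi (J_sub W) n (phi n v).
Proof. exact: (quom_map_pi (@H0_map_proof k V W phi n)). Qed.

(** Let K be the kernel of the cover of [Z]. Right exactness of H0 identifies the cokernel of H0 of
    the incoming differential with H0 K, so the homology is the kernel of the map from H0 K to H0 of
    the cover. *)
Lemma homology_vanishes s V :
  vanishes (homology s.+1 V) <->
    pureT (incl (cker (cover_map (iter s (@syzygy k) V)))).
Proof.
rewrite [homology _ _]/(subquo _ _) subquo_vanishes.
set Z := iter s (@syzygy k) V; set c := cover_map (syzygy Z).
have cS : chom_surj c := @cover_map_surj k (syzygy Z).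
split=> [H n z|H n y /eqP].
  rewrite !deficientT => zJ; have [p pz] := cS n z.
  have /asboolP[w] :
      quo_pi (J_sub (res V s.+1)) n p \in cimg (H0_map (res_d V s.+1)) n.
    apply: H; apply/eqP; rewrite H0_map_pi; apply/quo_pi_eq0.
    have -> : res_d V s n p = incl (cker (cover_map Z)) n (c n p) by [].
    by rewrite pz.
  have [u <-] := quo_pi_surj w; rewrite H0_map_pi => /quo_pi_eq.
  have cd : c n (res_d V s.+1 n u) = 0 by apply/(cker_exact c); eexists.
  move=> /(@H0_map_proof k _ _ c n _); rewrite linearB cd pz sub0r.
  by move=> /submod_rpredN; rewrite opprK.
have [p <-] := quo_pi_surj y; rewrite [X in X = _]H0_map_pi => /quo_pi_eq0.
(* Replacing [p] by p - p0 keeps its class in H0 and puts it in the kernel of [c], hence in the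
   image of the differential. *)
rewrite -deficientT => /H /(lift_deficient cS)[p0 p0J cp].
have /(cker_exact c)[u uE] : c n (p - p0) = 0 by rewrite linearB cp subrr.
have [q qE] := @cover_map_surj k _ n u.
apply/asboolP; exists (quo_pi _ n q); rewrite H0_map_pi; apply/quo_pi_eq.
rewrite (_ : res_d V s.+1 n q = p - p0); last by rewrite -uE -qE.
by rewrite addrAC subrr add0r submod_rpredN // -deficientT.
Qed.

Lemma saturated_iter_syzygy s V : saturated (iter s (@syzygy k) V) <-> saturated V.
Proof. by elim: s => //= s <-; exact: saturated_syzygy. Qed.

Lemma hd_ninfty s V : hd s.+1 V = -oo%E <-> saturated V.
Proof.
rewrite /hd td_ninfty; last exact/trivial_quo/trivial_sub/trivial_H0.
by rewrite homology_vanishes saturated_syzygy_pureT saturated_iter_syzygy.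
Qed.
End Homology.

(** * From filtrations to saturation *)

Section SubIncl.
Variables (k : comPzRingType) (V : cmod k) (A B : csub V).
Hypothesis AB : forall n v, v \in A n -> v \in B n.

Definition sub_incl_fun n (x : sub_cmod A n) : sub_cmod B n := Subm (AB (valP x)).
Fact sub_incl_linear n : linear (@sub_incl_fun n).
Proof. by move=> a x y; exact: val_inj. Qed.
Fact sub_incl_act m n (f : inj m n) x :
  mk_linear (@sub_incl_linear n) (act (sub_cmod A) f x) =
  act (sub_cmod B) f (mk_linear (@sub_incl_linear m) x).
Proof. exact: val_inj. Qed.
Definition sub_incl : chom (sub_cmod A) (sub_cmod B) :=
  @CHom k (sub_cmod A) (sub_cmod B) (fun n => mk_linear (@sub_incl_linear n))
    sub_incl_act.

Lemma sub_incl_inj : chom_inj sub_incl.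
Proof. by move=> n x y /(congr1 val) /= xy; apply: val_inj. Qed.

Lemma sub_incl_exact : exact_at sub_incl (quo_pi (cpreim (incl B) A)).
Proof.
move=> n x; rewrite quo_pi_eq0; split=> [xA|[u <-]]; last exact: (valP u).
by exists (Subm (xA : val x \in A n)); exact: val_inj.
Qed.
End SubIncl.

Section SharpSaturated.
Variable k : comPzRingType.
Implicit Types V W : cmod k.

Lemma saturated_bij V W (phi : chom V W) :
  (forall n, bijective (phi n)) -> saturated W -> saturated V.
Proof.
move=> phiB Ws n b B x /(hom_deficient phi); rewrite hom_act => /Ws.
have phiS : chom_surj phi by move=> m w; have [h _ hK] := phiB m; exists (h w).
by case/(lift_deficient phiS) => y yB /(bij_inj (phiB n)) <-.
Qed.

Lemma inj_surj_iso V W (phi : chom V W) :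
  chom_inj phi -> chom_surj phi -> cmod_iso W V.
Proof.
move=> phiI phiS.
pose h n := projT1 (boolp.choice (phiS n)).
have hK n : cancel (h n) (phi n) by exact: projT2 (boolp.choice (phiS n)).
have hL n : linear (h n) by move=> a x y; apply: phiI; rewrite linearP !hK.
have hA m n (f : inj m n) w :
    mk_linear (hL n) (act W f w) = act V f (mk_linear (hL m) w).
  by apply: phiI; rewrite hom_act /= !hK.
exists (@CHom k W V (fun n => mk_linear (hL n)) hA) => n.
by exists (phi n) => [|x]; [exact: hK | apply: phiI; rewrite hK].
Qed.

(** Induction up the filtration by [saturated_extension], from the zero module and with basic
    layers. *)
Lemma sharp_filtered_saturated V : sharp_filtered V -> saturated V.
Proof.
move=> [r [F [F0 Fr FS Fb]]].
have Fsat j : (j <= r.+1)%N -> saturated (sub_cmod (F j)).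
  elim: j => [_|j IH jr].
    move=> n b B x _; rewrite (_ : x = 0) ?rpred0 //.
    by apply: val_inj; exact: F0 (valP x).
  have [i [T [phi phiB]]] := Fb j jr.
  have FSj n v : v \in F j n -> v \in F j.+1 n by exact: FS.
  have ext := saturated_extension (@sub_incl_inj _ _ _ _ FSj) (@quo_pi_surj _ _ _)
    (@sub_incl_exact _ _ _ _ FSj).
  apply: ext.
    by apply: IH; exact: ltnW.
  exact: saturated_bij phiB (@saturated_basic _ _ T).
move=> n b B x xB.
have iS : chom_surj (incl (F r.+1)) by move=> m v; exists (Subm (Fr m v)).
have [u uB ux] := lift_deficient iS xB.
rewrite -[x]/(incl (F r.+1) n (Subm (Fr n x))); apply: hom_deficient.
apply: (Fsat _ (leqnn _) _ b).
suff <- : u = act (sub_cmod (F r.+1)) (coface b) (Subm (Fr n x)) by [].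
exact: val_inj.
Qed.

(** * The filtration by generation degree *)

Section Low.
Variable V : cmod k.

Definition low_gen j n : set (V n) := fun w =>
  exists m (f : inj m n) (v : V m), (m < j)%N /\ act V f v = w.

Fact low_act j m n (f : inj m n) v :
  v \in span (@low_gen j m) -> act V f v \in span (@low_gen j n).
Proof.
apply: span_map => _ [l [g [u [lj <-]]]]; apply: mem_span.
by exists l, (icomp f g), u; rewrite act_comp.
Qed.
Definition low j : csub V := CSub (@low_act j).

Lemma mem_low j m n (f : inj m n) (v : V m) : (m < j)%N -> act V f v \in low j n.
Proof. by move=> mj; apply: mem_span; exists m, f, v. Qed.

Lemma low_full j n (v : V n) : (n < j)%N -> v \in low j n.
Proof. by move=> nj; rewrite -[v]act_id; exact: mem_low. Qed.

Lemma lowS j n (v : V n) : v \in low j n -> v \in low j.+1 n.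
Proof.
apply: (@span_map _ _ _ _ _ (idfun : {linear V n -> V n})).
by move=> _ [m [f [u [mj <-]]]]; apply/mem_low/ltnW.
Qed.

Lemma mem_J (W : cmod k) m n (f : inj m n) (v : W m) :
  (m < n)%N -> act W f v \in deficient W [set: 'I_n].
Proof. by move=> mn; rewrite deficientT; apply: mem_span; exists m, f, v. Qed.

(** Below degree [j] the submodule is everything; from degree [j] on, all of it comes from smaller
    degrees, hence lies in its own J. *)
Lemma low_pureT j : pureT (incl (low j)).
Proof.
move=> n x xJ.
suff: exists2 u, u \in deficient (sub_cmod (low j)) [set: 'I_n] & val u = val x.
  by case=> u uJ /val_inj <-.
have gen m (f : inj m n) (v : V m) : (m < j)%N -> (m < n)%N ->
    exists2 u, u \in deficient (sub_cmod (low j)) [set: 'I_n] & val u = act V f v.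
  move=> mj mn; exists (act (sub_cmod (low j)) f (Subm (low_full v mj))) => //.
  exact: mem_J.
pose P (y : V n) :=
  exists2 u, u \in deficient (sub_cmod (low j)) [set: 'I_n] & val u = y.
rewrite -/(P (val x)).
have P0 : P 0 by exists 0; rewrite ?rpred0.
have PD y z : P y -> P z -> P (y + z).
  by move=> [u uJ <-] [v vJ <-]; exists (u + v); rewrite ?rpredD.
have PZ c y : P y -> P (c *: y).
  by move=> [u uJ <-]; exists (c *: u); rewrite ?rpredZ.
have [nj|jn] := ltnP n j.
  move: xJ; rewrite deficientT; apply: (span_ind P0 PD PZ) => _ [m [f [v [mn <-]]]].
  by apply: gen => //; exact: ltn_trans nj.
apply: (span_ind P0 PD PZ _ (valP x)) => _ [m [f [v [mj <-]]]].
by apply: gen => //; exact: leq_trans jn.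
Qed.

Hypothesis Vs : saturated V.

Lemma low_pure j : pure (incl (low j)).
Proof. exact: pureT_pure (@low_pureT j) Vs. Qed.

Lemma saturated_low j : saturated (sub_cmod (low j)).
Proof. exact: saturated_kernel (@low_pure j) Vs. Qed.

Lemma saturated_low_quo j : saturated (subquo (low j) (low j.+1)).
Proof.
apply: (saturated_cokernel (@quo_pi_surj _ _ _) (@sub_incl_exact _ _ _ _ (@lowS j)) _
  (@saturated_low j.+1)).
(* Deficiency in [low j.+1] implies deficiency in [V], where purity of [low j] is known. *)
move=> n B x xB; apply: (@low_pure j).
exact: (hom_deficient (incl (low j.+1)) xB).
Qed.
End Low.

Definition generated_in V j : Prop := forall n (S : submodClosed (V n)),
  (forall (f : inj j n) v, act V f v \in S) -> forall x, x \in S.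

(** Generators of [low V j.+1] from degrees below [j] vanish in the quotient, leaving those from
    degree [j]. *)
Lemma low_quo_generated V j : generated_in (subquo (low V j) (low V j.+1)) j.
Proof.
move=> n S fS x; have [u <-] := quo_pi_surj x.
pose q := quo_pi (cpreim (incl (low V j.+1)) (low V j)).
suff [w [wu wS]] : exists w : sub_cmod (low V j.+1) n, val w = val u /\ q n w \in S.
  by rewrite -(val_inj wu).
pose P (y : V n) := exists w : sub_cmod (low V j.+1) n, val w = y /\ q n w \in S.
apply: (@span_ind _ _ _ P _ _ _ _ _ (valP u)).
- by exists 0; split=> //; rewrite linear0; exact: rpred0.
- move=> _ _ [w [<- wS]] [w' [<- wS']]; exists (w + w'); split=> //.
  by rewrite linearD; exact: rpredD.
- move=> c _ [w [<- wS]]; exists (c *: w); split=> //.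
  by rewrite linearZ; exact: rpredZ.
move=> _ [m [f [v [mj <-]]]].
exists (act (sub_cmod (low V j.+1)) f (Subm (low_full v mj))); split=> //.
have [mjE|mj'] : m = j \/ (m < j)%N.
  by move: mj; rewrite ltnS leq_eqVlt => /orP[/eqP|]; [left|right].
  by subst m; rewrite hom_act; exact: fS.
rewrite (_ : q n _ = 0) ?rpred0 //; apply/quo_pi_eq0; exact: mem_low.
Qed.

(** * Saturated modules generated in a single degree *)

Section Generated.
Variables (V : cmod k) (j : nat).
Hypotheses (Vs : saturated V) (Vg : generated_in V j).

Definition value_symmod : symmod k j :=
  @SymMod k j (V j) (fun f => act V f) (@act_id k V j) (@act_comp k V j j j).

Definition ev_fun n (x : ind j (V j) n) : V n := \sum_g act V g (x g).
Fact ev_linear n : linear (@ev_fun n).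
Proof.
move=> a x y; rewrite /ev_fun scaler_sumr -big_split /=.
by apply: eq_bigr => g _; rewrite !ffunE linearP.
Qed.

Lemma ev_tensor n (g : inj j n) v : ev_fun (ind_tensor g v) = act V g v.
Proof.
rewrite /ev_fun (bigD1 g) //= ffunE eqxx big1 ?addr0 // => h /negPf hg.
by rewrite ffunE hg linear0.
Qed.

Fact ev_act m n (f : inj m n) x :
  mk_linear (@ev_linear n) (act (ind j (V j)) f x) =
  act V f (mk_linear (@ev_linear m) x).
Proof.
rewrite /= /ev_fun linear_sum /=.
under eq_bigr do rewrite ffunE linear_sum.
rewrite (exchange_big_dep xpredT) //=; apply: eq_bigr => h _.
by rewrite (big_pred1 (icomp f h)) ?act_comp // => g; rewrite /= eq_sym.
Qed.
Definition ev : chom (ind j (V j)) V :=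
  @CHom k (ind j (V j)) V (fun n => mk_linear (@ev_linear n)) ev_act.

Let rel : csub (ind j (V j)) := CSub (@tensor_rel_act k j value_symmod).

Lemma ev_rel n x : x \in rel n -> ev n x = 0.
Proof.
move: x; apply: span_ind.
- exact: linear0.
- by move=> x y x0 y0; rewrite linearD x0 y0 addr0.
- by move=> c x x0; rewrite linearZ_LR x0 scaler0.
move=> _ [g [s [t ->]]].
by rewrite linearB [X in X - _]ev_tensor [X in _ - X]ev_tensor act_comp subrr.
Qed.

Definition basic_ev : chom (basic_filtered value_symmod) V := quo_desc ev_rel.

Lemma basic_ev_surj : chom_surj basic_ev.
Proof.
move=> n v; have /asboolP[x xv] : v \in cimg basic_ev n; last by exists x.
apply: Vg => f w; apply/asboolP; exists (quo_pi rel n (ind_tensor f w)).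
by rewrite quo_descE; exact: ev_tensor.
Qed.

(** In degree [j] all maps are permutations, which the relations move across the tensor onto
    [V j]. *)
Lemma basic_degree_id (x : ind j (V j) j) :
  quo_pi rel j x = quo_pi rel j (ind_tensor (iid j) (ev j x)).
Proof.
apply/quo_pi_eq; rewrite {1}[x]ind_sum_tensor.
pose t (v : V j) : ind j (V j) j := ind_tensor (iid j) v.
have t_sum (F : inj j j -> V j) : t (\sum_g F g) = \sum_g t (F g).
  apply/ffunP => h; rewrite sum_ffunE ffunE; case: (eqVneq h (iid j)) => [->|hj].
    by apply: eq_bigr => g _; rewrite ffunE eqxx.
  by rewrite big1 // => g _; rewrite ffunE (negPf hj).
rewrite -/(t _) [ev j x]/(ev_fun x) /ev_fun t_sum -sumrB.
apply: rpred_sum => s _; apply: mem_span.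
by exists (iid j), s, (x s); rewrite icomp1f.
Qed.

(** By induction on the degree. Below [j] the basic module is zero, and at [j] [basic_degree_id]
    applies. Above [j] it equals its own J, so by purity, which saturation of [V] provides, the
    kernel lies in its own J and comes from degrees where it is zero. *)
Lemma basic_ev_kernel n (x : sub_cmod (cker basic_ev) n) : x = 0.
Proof.
have [m] := ubnP n; elim: m n x => // m IH n x nm.
have xT : incl _ n x \in deficient (basic_filtered value_symmod) [set: 'I_n] ->
    x = 0.
  move=> /(saturated_cokernel_pure (@incl_inj _ _ _) basic_ev_surj
    (@cker_exact _ _ _ _) Vs); rewrite deficientT.
  move: x; apply: span_ind.
  - by [].
  - by move=> x y -> ->; rewrite addr0.
  - by move=> c x ->; rewrite scaler0.
  - move=> z [l [f [v [ln <-]]]]; rewrite (IH _ v) ?linear0 //.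
    exact: leq_trans ln _.
have [y yx] := quo_pi_surj (incl _ n x).
have [nj|nj|nj] := ltngtP n j.
- apply: val_inj; rewrite -[LHS]/(incl (cker basic_ev) n x) -yx.
  apply/quo_pi_eq0; rewrite (_ : y = 0) ?rpred0 //; apply/ffunP => g.
  by have := inj_leq g; rewrite leqNgt nj.
- apply: xT; rewrite -yx; apply: hom_deficient; rewrite (ind_sum_tensor y).
  apply: rpred_sum => g _.
  by rewrite -[g]icompf1 -ind_act_tensor; exact: mem_J.
subst n; apply: val_inj; rewrite -[LHS]/(incl (cker basic_ev) j x) -yx.
rewrite basic_degree_id (_ : ev j y = 0).
  apply/quo_pi_eq0; rewrite (_ : ind_tensor _ _ = 0) ?rpred0 //.
  by apply/ffunP => h; rewrite !ffunE if_same.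
by rewrite -(quo_descE ev_rel) yx; exact/eqP/(valP x).
Qed.

Lemma generated_basic : is_basic_filtered V.
Proof.
exists j, value_symmod; apply: (inj_surj_iso _ basic_ev_surj) => n x y xy.
have xyK : x - y \in cker basic_ev n by apply/eqP; rewrite linearB xy subrr.
have /(congr1 val)/= := basic_ev_kernel (Subm xyK).
by move=> /eqP; rewrite subr_eq0 => /eqP.
Qed.
End Generated.

(** * From saturation to filtrations *)

Lemma low_finitely_generated V : finitely_generated V ->
  exists r, forall n (v : V n), v \in low V r n.
Proof.
(* One more than the largest generating degree, since [low] is generated in degrees strictly below
   its index. *)
move=> [r [d [phi phiS]]]; exists (\max_j d j).+1 => n v.
have [u <-] := phiS n v.
apply: (@dsum_mem k _ _ n (preim_sub (phi n) (low V _ n))) => a.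
rewrite [_ \in _]/(phi n _ \in _) [val u a]ind_sum_tensor !linear_sum.
apply: rpred_sum => g _; rewrite -[g]icompf1 -ind_act_tensor !hom_act.
by apply: mem_low; rewrite ltnS; exact: (leq_bigmax a).
Qed.

Lemma saturated_sharp_filtered V :
  finitely_generated V -> saturated V -> sharp_filtered V.
Proof.
move=> /low_finitely_generated[r Vr] Vs; exists r, (low V); split.
- move=> n v; move: v; apply: span_ind => //.
  + by move=> x y -> ->; rewrite addr0.
  + by move=> c x ->; rewrite scaler0.
  + by move=> z [m [f [v []]]].
(* [sharp_filtered] numbers its top term [r.+1], while [low V r] is already everything; the last
   layer is zero. *)
- by move=> n v; exact/lowS/Vr.
- by move=> j n v _; exact: lowS.
- move=> j _; apply: (@generated_basic _ j).
  + exact: saturated_low_quo.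
  + exact: low_quo_generated.
Qed.
End SharpSaturated.

Local Close Scope ring_scope.

Theorem theorem1p3 (k : comPzRingType) (V : cmod k)
    (kN : noetherian k) (Vfg : finitely_generated V) :
  [<-> sharp_filtered V;
       forall s : nat, (1 <= s)%N -> hd s V = -oo%E;
       hd 1 V = -oo%E;
       exists2 s : nat, (1 <= s)%N & hd s V = -oo%E].
Proof.
tfae.
- by move=> /sharp_filtered_saturated Vs [//|s] _; exact/hd_ninfty.
- exact.
- by exists 1.
- by move=> [[//|s] _ /hd_ninfty]; exact: saturated_sharp_filtered.
Qed.
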